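(* Assume strong ignorability: $(Y^0,Y^1)\perp\!\!\!\perp A\mid X$ and $0<e(x)<1$ for all $x$. (a) If in addition monotonicity $Y^0\le Y^1$ holds (so $\beta=1-\mu_0/\mu_1$), then the semiparametric efficiency bound of $\beta$ when the propensity score $e(X)$ is known, $\mathbb{E}[\tilde\phi_\beta^2]$, is smaller than the bound when $e(X)$ is unknown, $\mathbb{E}[\phi_\beta^2]$, and the magnitude of this difference is $$\mathbb{E}[\phi_\beta^2]-\mathbb{E}[\tilde\phi_\beta^2]=\mathbb{E}\left[\frac{1}{\mu_1^4}(\mu_0\mu_1(X)-\mu_1\mu_0(X))^2e(X)(1-e(X))\right].$$ (b) If instead in addition conditional independence $Y^0\perp\!\!\!\perp Y^1\mid X$ holds (so $\beta=1-\mu/\mu_1$), then the semiparametric efficiency bound of $\beta$ when the propensity score $e(X)$ is known, $\mathbb{E}[\tilde\varphi_\beta^2]$, is lower than the bound when $e(X)$ is unknown, $\mathbb{E}[\varphi_\beta^2]$, and the magnitude of this difference is $$\mathbb{E}[\varphi_\beta^2]-\mathbb{E}[\tilde\varphi_\beta^2]=\mathbb{E}\left[\frac{1}{\mu_1^4}(\mu\mu_1(X)-\mu_1\mu_1(X)\mu_0(X))^2e(X)(1-e(X))\right].$$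
   Context: Setting: $X$ is a $p$-dimensional covariate vector, $A\in\{0,1\}$ a binary cause, $Y\in\{0,1\}$ a binary outcome, $Y^0,Y^1\in\{0,1\}$ the potential outcomes, with $Y=AY^1+(1-A)Y^0$. The propensity score is $e(x)=\mathbb{P}(A=1\mid X=x)$; the outcome regressions are $\mu_a(x)=\mathbb{P}(Y=1\mid X=x,A=a)$, $a=0,1$. Constants: $\mu_a=\mathbb{E}[\mu_a(X)e(X)]$ for $a=0,1$, and $\mu=\mathbb{E}[\mu_1(X)\mu_0(X)e(X)]$. The probability of necessary causation is $\beta=\mathbb{P}(Y^0=0\mid A=1,Y=1)$, where $\mathbb{P}(A=1,Y=1)>0$. The semiparametric efficiency bounds are the second moments of the following efficient influence functions of $\beta$. Under strong ignorability and monotonicity, with $e$ unknown: $$\phi_\beta=\frac{\mu_0}{\mu_1^2}A(Y-\mu_1(X))-\frac{e(X)}{\mu_1}\frac{1-A}{1-e(X)}(Y-\mu_0(X))+\frac{1}{\mu_1^2}[\mu_0\mu_1(X)-\mu_1\mu_0(X)]A,$$ and with $e$ known: $$\tilde\phi_\beta=\frac{\mu_0}{\mu_1^2}A(Y-\mu_1(X))-\frac{e(X)}{\mu_1}\frac{1-A}{1-e(X)}(Y-\mu_0(X))+\frac{\mu_0}{\mu_1^2}\mu_1(X)e(X)-\frac{1}{\mu_1}\mu_0(X)e(X).$$ Under strong ignorability and conditional independence, with $e$ unknown: $$\varphi_\beta=A\,\frac{\mu-\mu_1\mu_0(X)}{\mu_1^2}(Y-\mu_1(X))-\frac{e(X)}{\mu_1}\frac{1-A}{1-e(X)}(Y-\mu_0(X))\mu_1(X)+\frac{\mu-\mu_1\mu_0(X)}{\mu_1^2}\mu_1(X)A,$$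 and with $e$ known: $$\tilde\varphi_\beta=\Big(\frac{\mu}{\mu_1^2}-\frac{\mu_0(X)}{\mu_1}\Big)A(Y-\mu_1(X))-\frac{e(X)}{\mu_1}\frac{1-A}{1-e(X)}\mu_1(X)(Y-\mu_0(X))+\Big(\frac{\mu}{\mu_1^2}-\frac{\mu_0(X)}{\mu_1}\Big)\mu_1(X)e(X).$$ *)

(* Defs.v *)
(* MathComp / MathComp-Analysis *)
From mathcomp Require Import all_boot all_order all_algebra.
From mathcomp Require Import all_classical all_reals all_analysis.

Set Implicit Arguments.
Unset Strict Implicit.
Unset Printing Implicit Defensive.

Import Order.TTheory GRing.Theory Num.Theory.

Local Open Scope classical_set_scope.
Local Open Scope ring_scope.
Local Open Scope ereal_scope.

Section conditioning.
Context {dO : measure_display} {Omega : measurableType dO} {R : realType}.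
Variable P : probability Omega R.

(* [g] is a version of z |-> P(E | Z = z), i.e. g(Z) is a version of
   P(E | sigma(Z)).  No integrability is required: taking B = {g >= 0} and
   B = {g < 0} forces g(Z) to be a.s. nonnegative with integral P(E). *)
Definition is_cond_prob {d} {S : measurableType d}
    (Z : Omega -> S) (E : set Omega) (g : S -> R) : Prop :=
  measurable_fun setT g /\
  forall B : set S, measurable B ->
    P (E `&` Z @^-1` B) = \int[P]_(w in Z @^-1` B) (g (Z w))%:E.

(* U and V are conditionally independent given Z:
   P(U \in B, V \in C | Z) = P(U \in B | Z) P(V \in C | Z) a.s.
   Versions are a.s. unique, so it does not matter which ones are used. *)
Definition cond_indep {d d1 d2} {S : measurableType d}
    {S1 : measurableType d1} {S2 : measurableType d2}
    (U : Omega -> S1) (V : Omega -> S2) (Z : Omega -> S) : Prop :=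
  forall (B : set S1) (C : set S2), measurable B -> measurable C ->
    exists g h : S -> R,
      [/\ is_cond_prob Z (U @^-1` B) g,
          is_cond_prob Z (V @^-1` C) h &
          is_cond_prob Z (U @^-1` B `&` V @^-1` C) (fun z => g z * h z)%R].

Definition cprob (E F : set Omega) : R := (fine (P (E `&` F)) / fine (P F))%R.

End conditioning.

Section causation.
Context {dO : measure_display} {Omega : measurableType dO} {R : realType}.
Context {d : measure_display} {S : measurableType d}.
Variables (P : probability Omega R) (X : Omega -> S).

Definition is_propensity (A : Omega -> bool) (e : S -> R) : Prop :=
  is_cond_prob P X [set w | A w] e.

(* mu_a(x) = P(Y = 1 | X = x, A = a), conditioning on the pair (X, A) *)
Definition is_outcome_regression (A Y : Omega -> bool) (mu0 mu1 : S -> R)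
    : Prop :=
  is_cond_prob P (fun w => (X w, A w)) [set w | Y w]
    (fun z => if z.2 then mu1 z.1 else mu0 z.1).

Definition strong_ignorability (A Y0 Y1 : Omega -> bool) (e : S -> R) : Prop :=
  cond_indep P (fun w => (Y0 w, Y1 w)) A X /\ (forall x, 0 < e x < 1)%R.

Definition monotonicity (Y0 Y1 : Omega -> bool) : Prop :=
  {ae P, forall w, (Y0 w <= Y1 w)%N}.

(* probability of necessary causation *)
Definition prob_necessity (A Y Y0 : Omega -> bool) : R :=
  cprob P [set w | ~~ Y0 w] [set w | A w && Y w].

Variables (e mu0 mu1 : S -> R).

Definition m0 : R := fine 'E_P[fun w => (mu0 (X w) * e (X w))%R].
Definition m1 : R := fine 'E_P[fun w => (mu1 (X w) * e (X w))%R].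
Definition m01 : R := fine 'E_P[fun w => (mu1 (X w) * mu0 (X w) * e (X w))%R].

(* The efficient influence functions of [prob_necessity]. *)
Section influence_functions.
Variables (A Y : Omega -> bool).
Local Open Scope ring_scope.

Definition eif_mono_unknown (w : Omega) : R :=
  m0 / m1 ^+ 2 * (A w)%:R * ((Y w)%:R - mu1 (X w))
  - e (X w) / m1 * ((1 - (A w)%:R) / (1 - e (X w))) * ((Y w)%:R - mu0 (X w))
  + 1 / m1 ^+ 2 * (m0 * mu1 (X w) - m1 * mu0 (X w)) * (A w)%:R.

Definition eif_mono_known (w : Omega) : R :=
  m0 / m1 ^+ 2 * (A w)%:R * ((Y w)%:R - mu1 (X w))
  - e (X w) / m1 * ((1 - (A w)%:R) / (1 - e (X w))) * ((Y w)%:R - mu0 (X w))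
  + m0 / m1 ^+ 2 * mu1 (X w) * e (X w)
  - 1 / m1 * mu0 (X w) * e (X w).

Definition eif_indep_unknown (w : Omega) : R :=
  (A w)%:R * ((m01 - m1 * mu0 (X w)) / m1 ^+ 2) * ((Y w)%:R - mu1 (X w))
  - e (X w) / m1 * ((1 - (A w)%:R) / (1 - e (X w))) * ((Y w)%:R - mu0 (X w)) * mu1 (X w)
  + (m01 - m1 * mu0 (X w)) / m1 ^+ 2 * mu1 (X w) * (A w)%:R.

Definition eif_indep_known (w : Omega) : R :=
  (m01 / m1 ^+ 2 - mu0 (X w) / m1) * (A w)%:R * ((Y w)%:R - mu1 (X w))
  - e (X w) / m1 * ((1 - (A w)%:R) / (1 - e (X w))) * mu1 (X w) * ((Y w)%:R - mu0 (X w))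
  + (m01 / m1 ^+ 2 - mu0 (X w) / m1) * mu1 (X w) * e (X w).

End influence_functions.
End causation.

(* A semiparametric efficiency bound is the second moment of the efficient
   influence function; it may be +oo since e is not bounded away from 1. *)
Definition efficiency_bound {dO : measure_display} {Omega : measurableType dO}
    {R : realType} (P : probability Omega R) (eif : Omega -> R) : \bar R :=
  'E_P[fun w => (eif w ^+ 2)%R].

(* Main.v *)
(* A version of P(E | Z) is a Radon-Nikodym density, with respect to the law of
   Z, of the measure B |-> P(E, Z in B).  Hence it is a.s. unique, takes values
   in [0, 1] a.s., and satisfies E[f(Z); E] = E[f(Z) g(Z)].

   Under ignorability mu_a is a version of P(Y^a = 1 | X), which identifies the
   probability of necessity.

   Each pair of influence functions has the form r + W(X) A (unknown e) and
   r + W(X) e(X) (known e), where r = h(X, A) (Y - mu_A(X)).  The difference of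
   their squares is
     2 W (A - e) h (Y - mu_A) + W^2 (A - e) + W^2 e (1 - e),
   and the first two terms have mean zero, by conditioning on (X, A) and on X.
   The factor 1 / (1 - e) in h is unbounded, but E[(1 - A) / (1 - e(X))] = 1
   makes the difference integrable, so the identity between the second moments
   also holds when both are infinite. *)
Require Import Defs.
From mathcomp Require Import all_boot all_order all_algebra.
From mathcomp Require Import all_classical all_reals all_analysis.
From HB Require Import structures.
From mathcomp Require Import measurable_realfun ring.

Set Implicit Arguments.
Unset Strict Implicit.
Unset Printing Implicit Defensive.

Import Order.TTheory GRing.Theory Num.Theory.

Local Open Scope classical_set_scope.
Local Open Scope ring_scope.
Local Open Scope ereal_scope.

(** * The measure B |-> P(E, Z in B) and its domination by the law of Z *)

Section joint_law.
Context {dO : measure_display} {Omega : measurableType dO} {R : realType}.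
Variable P : probability Omega R.
Context {d : measure_display} {S : measurableType d}.
Variables (Z : {mfun Omega >-> S}) (E : set Omega) (mE : measurable E).

(** Named so that it can carry the measure and finite-measure structures on which the Radon-Nikodym
    derivative rests. *)
Definition joint_law := pushforward (mrestr P mE) Z.

Let joint_law0 : joint_law set0 = 0. Proof. exact: measure0. Qed.

Let joint_law_ge0 A : 0 <= joint_law A. Proof. exact: measure_ge0. Qed.

Let joint_law_sigma_additive : semi_sigma_additive joint_law.
Proof. exact: measure_semi_sigma_additive. Qed.

HB.instance Definition _ := isMeasure.Build _ _ _ joint_law
  joint_law0 joint_law_ge0 joint_law_sigma_additive.

Let joint_law_fin : fin_num_fun joint_law.
Proof.
move=> B mB; have mZB : measurable (Z @^-1` B) by exact: measurable_funPTI.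
rewrite /joint_law /pushforward /mrestr.
by apply: fin_num_measure; exact: measurableI.
Qed.

HB.instance Definition _ := Measure_isFinite.Build _ _ _ joint_law joint_law_fin.

Lemma joint_law_dominated : joint_law `<< distribution P Z.
Proof.
move=> N nullN B mB BN; have mZB : measurable (Z @^-1` B).
  exact: measurable_funPTI.
apply/eqP; rewrite -measure_le0 -(nullN B mB BN).
by apply: le_measure; rewrite ?inE//; exact: measurableI.
Qed.

End joint_law.

Arguments joint_law_dominated {dO Omega R} P {d S} Z {E} mE.

(** * Versions of conditional probabilities as Radon-Nikodym densities *)

Section cond_prob.
Context {dO : measure_display} {Omega : measurableType dO} {R : realType}.
Variable P : probability Omega R.
Context {d : measure_display} {S : measurableType d}.
Variable Z : {mfun Omega >-> S}.

Lemma ae_distribution (p : S -> Prop) :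
  {ae distribution P Z, forall z, p z} -> {ae P, forall w, p (Z w)}.
Proof.
move=> [N [mN N0 subN]]; exists (Z @^-1` N); split => //.
- exact: measurable_funPTI.
- by move=> w /subN.
Qed.

(** Change of variables holds for nonnegative functions without integrability, so applying it to the
    positive and negative parts covers every measurable [f]. *)
Lemma integral_distribution_preimage (B : set S) (f : S -> \bar R) :
  measurable B -> measurable_fun [set: S] f ->
  \int[distribution P Z]_(z in B) f z = \int[P]_(w in Z @^-1` B) f (Z w).
Proof.
move=> mB mf; rewrite integralE [RHS]integralE.
rewrite !ge0_integral_pushforward//.
- by rewrite -(funepos_comp f Z) -(funeneg_comp f Z).
- exact/measurable_funTS/measurable_funeneg.
- exact/measurable_funTS/measurable_funepos.
Qed.

Lemma is_cond_prob_ae_eq (E : set Omega) (g h : S -> R) :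
    is_cond_prob P Z E g -> measurable_fun setT h ->
    {ae P, forall w, g (Z w) = h (Z w)} ->
  is_cond_prob P Z E h.
Proof.
move=> [mg gE] mh gh; split => // B mB; rewrite gE//.
apply: ae_eq_integral.
- exact: measurable_funPTI.
- by apply/measurable_EFinP/measurable_funTS/measurableT_comp.
- by apply/measurable_EFinP/measurable_funTS/measurableT_comp.
- by apply: filterS gh => w /= -> _.
Qed.

Lemma is_cond_prob_integrable (E : set Omega) (g : S -> R) :
    measurable E -> is_cond_prob P Z E g ->
  P.-integrable setT (fun w => (g (Z w))%:E).
Proof.
move=> mE [mg /(_ _ measurableT) gE].
have mgZ : measurable_fun setT (fun w => g (Z w)) by exact: measurableT_comp.
apply/integrableP; split; first exact/measurable_EFinP.
(* A finite value of the integral already forces integrability, since oo - oo is infinite by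
   convention; the value here is P(E). *)
rewrite integral_fin_num_abs// -(preimage_setT Z) -gE.
by rewrite preimage_setT setIT; exact: fin_num_measure.
Qed.

Lemma is_cond_prob_setC (E : set Omega) (g : S -> R) :
    measurable E -> is_cond_prob P Z E g ->
  is_cond_prob P Z (~` E) (fun z => 1 - g z)%R.
Proof.
move=> mE gE; have intg := is_cond_prob_integrable mE gE.
have [mg {}gE] := gE; split; first exact: measurable_funB.
move=> B mB; have mZB : measurable (Z @^-1` B) by exact: measurable_funPTI.
under eq_integral do rewrite EFinB.
rewrite integralB_EFin//; last 2 first.
- exact: finite_measure_integrable_cst.
- exact: integrableS intg.
rewrite integral_cst// mul1e -gE// setIC -setDE measureD//; last first.
  by rewrite -ge0_fin_numE//; exact: fin_num_measure.
by rewrite [E `&` _]setIC.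
Qed.

Let density (E : set Omega) (mE : measurable E) : S -> \bar R :=
  Radon_Nikodym_SigmaFinite.f (joint_law P Z mE) (distribution P Z).

(** Under the law of Z both functions have integral P(E, Z in B) over every measurable B, and this
    determines an integrable function almost everywhere. *)
Let cond_prob_density (E : set Omega) (mE : measurable E) (g : S -> R) :
  is_cond_prob P Z E g -> {ae P, forall w, density mE (Z w) = (g (Z w))%:E}.
Proof.
move=> [mg gE]; have dom := joint_law_dominated P Z mE.
suff : ae_eq (distribution P Z) setT (density mE) (EFin \o g).
  by move=> /ae_distribution; apply: filterS => w /= ->.
apply: integral_ae_eq => //.
- exact: Radon_Nikodym_SigmaFinite.f_integrable.
- exact/measurable_EFinP.
- move=> B _ mB; rewrite -Radon_Nikodym_SigmaFinite.f_integral//.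
  rewrite integral_distribution_preimage//=; last exact/measurable_EFinP.
  by rewrite -gE// setIC.
Qed.

Lemma is_cond_prob_unique (E : set Omega) (g h : S -> R) : measurable E ->
    is_cond_prob P Z E g -> is_cond_prob P Z E h ->
  {ae P, forall w, g (Z w) = h (Z w)}.
Proof.
move=> mE /(cond_prob_density mE) gE /(cond_prob_density mE).
by apply: filterS2 gE => w -> [].
Qed.

Lemma is_cond_prob_ge0 (E : set Omega) (g : S -> R) : measurable E ->
  is_cond_prob P Z E g -> {ae P, forall w, (0 <= g (Z w))%R}.
Proof.
move=> mE /(cond_prob_density mE); apply: filterS => w gE.
by rewrite -lee_fin -gE Radon_Nikodym_SigmaFinite.f_ge0//; exact: joint_law_dominated.
Qed.

Lemma is_cond_prob_le1 (E : set Omega) (g : S -> R) : measurable E ->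
  is_cond_prob P Z E g -> {ae P, forall w, (g (Z w) <= 1)%R}.
Proof.
move=> mE /is_cond_prob_setC-/(_ mE)/is_cond_prob_ge0 -/(_ (measurableC mE)).
by apply: filterS => w; rewrite subr_ge0.
Qed.

(** The left side is the integral of [f] against [joint_law]; the Radon-Nikodym density turns it
    into an integral against the law of Z. Nonnegativity of [f] allows infinite values. *)
Let ge0_cond_prob_integral (E : set Omega) (g f : S -> R) : measurable E ->
    is_cond_prob P Z E g -> measurable_fun setT f -> (forall z, 0 <= f z)%R ->
  \int[P]_(w in E) (f (Z w))%:E = \int[P]_w (f (Z w) * g (Z w))%:E.
Proof.
move=> mE gE mf f0; have dom := joint_law_dominated P Z mE.
have mfE : measurable_fun setT (EFin \o f) by exact/measurable_EFinP.
have mdens : measurable_fun setT (density mE).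
  exact: measurable_int (Radon_Nikodym_SigmaFinite.f_integrable dom).
have [mg _] := gE.
transitivity (\int[joint_law P Z mE]_z (f z)%:E).
  rewrite ge0_integral_pushforward//=; last by move=> z _; rewrite lee_fin.
  rewrite preimage_setT.
  have mfZ : measurable_fun setT (fun w => (f (Z w))%:E).
    by apply/measurable_EFinP; exact: measurableT_comp.
  (* The restriction of P to E gives no mass to the complement of E and agrees with P on subsets of
     E. *)
  rewrite [RHS](@ge0_negligible_integral _ _ _ _ _ (~` E))//.
  - rewrite setTD setCK; apply: eq_measure_integral => A mA AE.
    by rewrite /= /mrestr setIidl.
  - exact: measurableC.
  - by move=> w _; rewrite lee_fin.
  - by rewrite /= /mrestr setICl measure0.
rewrite -(Radon_Nikodym_SigmaFinite.change_of_variables dom)//.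
rewrite integral_distribution_preimage//; last exact: emeasurable_funM.
rewrite preimage_setT; apply: ae_eq_integral => //.
- apply: emeasurable_funM; first exact/measurable_EFinP/measurableT_comp.
  exact: measurableT_comp.
- by apply/measurable_EFinP/measurable_funM; exact: measurableT_comp.
- by apply: filterS (cond_prob_density mE gE) => w fg _; rewrite EFinM -fg.
Qed.

Lemma is_cond_prob_integral (E : set Omega) (g f : S -> R) : measurable E ->
    is_cond_prob P Z E g -> measurable_fun setT f ->
  \int[P]_(w in E) (f (Z w))%:E = \int[P]_w (f (Z w) * g (Z w))%:E.
Proof.
move=> mE gE mf; have [mg _] := gE; have g0 := is_cond_prob_ge0 mE gE.
have mfg : measurable_fun setT (fun w => f (Z w) * g (Z w))%R.
  by apply: measurable_funM; exact: measurableT_comp.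
(* [k] stands for the positive or the negative part. Both are positively homogeneous, so the a.s.
   nonnegative factor g(Z) may be moved inside [k]. *)
have eqpart (k : R -> R) : measurable_fun setT k -> (forall r, 0 <= k r)%R ->
    (forall a b, 0 <= b -> k (a * b) = k a * b)%R ->
    \int[P]_(w in E) (k (f (Z w)))%:E = \int[P]_w (k (f (Z w) * g (Z w)))%:E.
  move=> mk k0 kM; rewrite (ge0_cond_prob_integral (f := k \o f) mE gE); last 2 first.
  - exact: measurableT_comp.
  - by move=> z; exact: k0.
  apply: ae_eq_integral => //.
  - apply/measurable_EFinP/measurable_funM; do 2?apply: measurableT_comp => //.
  - by apply/measurable_EFinP; exact: measurableT_comp.
  - by apply: filterS g0 => w /kM <- _.
rewrite integralE [RHS]integralE.
rewrite (funerpos (fun w => f (Z w))) (funerneg (fun w => f (Z w))).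
rewrite (funerpos (fun w => f (Z w) * g (Z w))%R).
rewrite (funerneg (fun w => f (Z w) * g (Z w))%R).
rewrite (eqpart (fun r => Num.max r 0)%R); last 3 first.
- exact: measurable_funrpos.
- by move=> r; rewrite le_max lexx orbT.
- by move=> a b b0; rewrite maxr_pMl// mul0r.
rewrite (eqpart (fun r => Num.max (- r) 0)%R)//.
- by apply: measurable_funrneg.
- by move=> r; rewrite le_max lexx orbT.
- by move=> a b b0; rewrite maxr_pMl// mul0r mulNr.
Qed.


(** [is_cond_prob_integral] for |f| equates the two integrals of absolute values, because g(Z) is
    a.s. nonnegative. *)
Lemma is_cond_prob_integrableM (E : set Omega) (g f : S -> R) : measurable E ->
    is_cond_prob P Z E g -> measurable_fun setT f ->
  P.-integrable E (fun w => (f (Z w))%:E) <->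
  P.-integrable setT (fun w => (f (Z w) * g (Z w))%:E).
Proof.
move=> mE gE mf; have [mg _] := gE; have g0 := is_cond_prob_ge0 mE gE.
have mfg : measurable_fun setT (fun w => f (Z w) * g (Z w))%R.
  by apply: measurable_funM; exact: measurableT_comp.
have mfZ : measurable_fun setT (fun w => f (Z w)) by exact: measurableT_comp.
have eq_abs : \int[P]_(w in E) `|(f (Z w))%:E| = \int[P]_w `|(f (Z w) * g (Z w))%:E|.
  rewrite (is_cond_prob_integral (f := fun z => `|f z|%R) mE gE); last first.
    exact: measurableT_comp.
  apply: ae_eq_integral => //.
  - apply/measurable_EFinP/measurable_funM; do 2?apply: measurableT_comp => //.
  - by apply/measurable_EFinP; exact: measurableT_comp.
  - by apply: filterS g0 => w g0 _ /=; rewrite normrM (ger0_norm g0).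
split=> /integrableP[_ fin]; apply/integrableP; split.
- exact/measurable_EFinP.
- by rewrite -eq_abs.
- exact/measurable_EFinP/measurable_funTS.
- by rewrite eq_abs.
Qed.

End cond_prob.

(** * Integration lemmas: domination, possibly infinite integrals, mean-zero residuals *)

Section integration.
Context {d : measure_display} {T : measurableType d} {R : realType}.
Variable mu : {measure set T -> \bar R}.

Lemma ae_le_integrable (f g : T -> R) : measurable_fun setT f ->
    mu.-integrable setT (EFin \o g) ->
    {ae mu, forall x, `|f x| <= `|g x|}%R ->
  mu.-integrable setT (EFin \o f).
Proof.
move=> mf /integrableP[/measurable_EFinP mg goo] fg; apply/integrableP; split.
  exact/measurable_EFinP.
apply: le_lt_trans goo; apply: ae_ge0_le_integral => //.
- by apply/measurable_EFinP; exact: measurableT_comp.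
- by apply/measurable_EFinP; exact: measurableT_comp.
- by apply: filterS fg => x fg _; rewrite lee_fin.
Qed.

(** An integrable difference makes [f] and [g] integrable together. If they are, this is additivity;
    otherwise both integrals are +oo and absorb the finite integral of the difference. *)
Lemma ge0_integral_eqD (f g : T -> R) :
    measurable_fun setT f -> measurable_fun setT g ->
    (forall x, 0 <= f x)%R -> (forall x, 0 <= g x)%R ->
    mu.-integrable setT (fun x => (f x - g x)%:E) ->
  \int[mu]_x (f x)%:E = \int[mu]_x (g x)%:E + \int[mu]_x (f x - g x)%:E.
Proof.
move=> mf mg f0 g0 intfg.
have ge0_integrable (h : T -> R) : measurable_fun setT h -> (forall x, 0 <= h x)%R ->
    \int[mu]_x (h x)%:E < +oo -> mu.-integrable setT (EFin \o h).
  move=> mh h0 hoo; apply/integrableP; split; first exact/measurable_EFinP.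
  by under eq_integral do rewrite gee0_abs ?lee_fin//=.
have fE : EFin \o f = (EFin \o g) \+ (fun x => (f x - g x)%:E).
  by apply/funext => x /=; rewrite -EFinD addrC subrK.
have gE : EFin \o g = (EFin \o f) \- (fun x => (f x - g x)%:E).
  by apply/funext => x /=; rewrite -EFinB subKr.
have [gy|gy] := ltP (\int[mu]_x (g x)%:E) +oo.
  rewrite -[LHS]/(\int[mu]_x (EFin \o f) x) fE integralD_EFin//.
  exact: ge0_integrable.
have [fy|fy] := ltP (\int[mu]_x (f x)%:E) +oo.
  suff /(integrable_lty measurableT) : mu.-integrable setT (EFin \o g).
    by rewrite /= ltNge gy.
  by rewrite gE; apply: integrableB => //; exact: ge0_integrable.
move: gy fy; rewrite !leye_eq => /eqP -> /eqP ->.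
have := integrable_fin_num measurableT intfg.
by rewrite fin_numE => /andP[intNy _]; rewrite addye.
Qed.

Lemma ae_eq_measure (E F : set T) : measurable E -> measurable F ->
  {ae mu, forall x, E x <-> F x} -> mu E = mu F.
Proof.
move=> mE mF EF; rewrite -(setIT E) -(setIT F) -!integral_indic//.
apply: ae_eq_integral => //; [exact/measurable_EFinP/measurable_indic..|].
apply: filterS EF => x EF _; rewrite !indicE; congr (_%:R)%:E.
by congr nat_of_bool; apply/idP/idP; rewrite !inE EF.
Qed.

End integration.

Lemma indic_bool {T : Type} {R : pzRingType} (b : T -> bool) (x : T) :
  \1_[set y | b y] x = (b x)%:R :> R.
Proof. by rewrite indicE; congr (_ _)%:R; apply/idP/idP; rewrite inE. Qed.

(** Orthogonality of a conditional residual to functions of Z: f(Z) 1_E and f(Z) g(Z) have the same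
    integral, and integrability of f(Z) passes to the first and from there to the second. *)
Lemma is_cond_prob_residual {dO : measure_display} {Omega : measurableType dO}
    {R : realType} (P : probability Omega R) {d : measure_display}
    {S : measurableType d} (Z : {mfun Omega >-> S}) (E : set Omega) (g f : S -> R) :
    measurable E -> is_cond_prob P Z E g -> measurable_fun setT f ->
    P.-integrable setT (fun w => (f (Z w))%:E) ->
  P.-integrable setT (fun w => (f (Z w) * (\1_E w - g (Z w)))%:E) /\
  \int[P]_w (f (Z w) * (\1_E w - g (Z w)))%:E = 0.
Proof.
move=> mE gE mf intf.
have intE : P.-integrable E (fun w => (f (Z w))%:E) by exact: integrableS intf.
have intg := (is_cond_prob_integrableM mE gE mf).1 intE.
move/(integrable_mkcond _ mE) : (intE); rewrite epatch_indic => int1.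
have resE : (fun w => (f (Z w) * (\1_E w - g (Z w)))%:E) =
    (EFin \o (fun w => f (Z w) * \1_E w)%R) \- (EFin \o (fun w => f (Z w) * g (Z w))%R).
  by apply/funext => w /=; rewrite mulrBr.
split; first by rewrite resE; exact: integrableB.
rewrite resE integralB_EFin//= -(is_cond_prob_integral mE gE mf).
rewrite [X in _ - X]integral_mkcond epatch_indic subee//.
exact: integrable_fin_num int1.
Qed.

(** * The gap between second moments for a general pair of influence functions *)

Section causation.
Context {dO : measure_display} {Omega : measurableType dO} {R : realType}.
Context {d : measure_display} {S : measurableType d}.
Variables (P : probability Omega R) (X : {mfun Omega >-> S}).

Lemma measurable_bool_event (B : {mfun Omega >-> bool}) : measurable [set w | B w].
Proof. by have : measurable (B @^-1` [set true]) by exact: measurable_funPTI. Qed.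

Section covariate_treatment.
Variable A : {mfun Omega >-> bool}.
Let XA_fun (w : Omega) : (S * bool)%type := (X w, A w).
Let XA_measurable : measurable_fun setT XA_fun.
Proof. exact: measurable_fun_pair. Qed.
HB.instance Definition _ := isMeasurableFun.Build _ _ _ _ XA_fun XA_measurable.
(** Bundled as a measurable function so that the results on conditioning apply with Z = (X, A). *)
Definition covariate_treatment : {mfun Omega >-> (S * bool)%type} := XA_fun.
End covariate_treatment.

Variables (A Y : {mfun Omega >-> bool}) (e mu0 mu1 : S -> R).
Hypothesis he : is_propensity P X A e.
Hypothesis hmu : is_outcome_regression P X A Y mu0 mu1.
Hypothesis e01 : forall x, (0 < e x < 1)%R.

Let mA : measurable [set w | A w] := measurable_bool_event A.
Let mY : measurable [set w | Y w] := measurable_bool_event Y.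
Let me : measurable_fun setT e := he.1.

Lemma measurable_outcome_regression :
  measurable_fun setT mu0 /\ measurable_fun setT mu1.
Proof.
have [mmu _] := hmu; split.
- exact: (measurableT_comp mmu (pair2_measurable false)).
- exact: (measurableT_comp mmu (pair2_measurable true)).
Qed.

Lemma measurable_inv_onem_propensity : measurable_fun setT (fun x => (1 - e x)^-1)%R.
Proof.
(* Since 1 - e is positive, its inverse is a real power, and power functions are measurable. *)
have -> : (fun x => (1 - e x)^-1)%R = (fun x => (1 - e x) `^ (-1))%R.
  apply/funext => x; rewrite powR_inv1// subr_ge0 ltW//.
  by have /andP[] := e01 x.
apply: (measurableT_comp (measurable_powR (-1)%R)).
exact: measurable_funB.
Qed.

(** As 1 - e is a version of P(A = 0 | X), integrating 1 / (1 - e(X)) over A = 0 amounts to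
    integrating (1 - e) / (1 - e) = 1 over the whole space. *)
Lemma integrable_inverse_propensity : P.-integrable setT
  (fun w => ((1 - (A w)%:R) / (1 - e (X w)))%:E).
Proof.
have mC := measurableC mA.
have heC := is_cond_prob_setC mA he.
have minv := measurable_inv_onem_propensity.
have : P.-integrable (~` [set w | A w]) (fun w => ((1 - e (X w))^-1)%:E).
  apply/(is_cond_prob_integrableM mC heC minv).
  apply: eq_integrable (finite_measure_integrable_cst P 1 measurableT) => //.
  move=> w _ /=; rewrite mulVf//; have /andP[_ e1] := e01 (X w).
  by rewrite subr_eq0 gt_eqF.
move/(integrable_mkcond _ mC); apply: eq_integrable => // w _.
rewrite epatch_indic /= -EFinM mulrC; congr (_ * _)%:E.
rewrite indicE in_setC -[X in ~~ X]negbK; have := @indic_bool _ R A w.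
by rewrite indicE; case: (w \in _) => /= <-; rewrite ?subrr ?subr0.
Qed.

(** The weights [u] of the treated and [v] of the untreated term are left free, so that one
    computation serves all four influence functions. *)
Definition residual (u v : S -> R) (w : Omega) : R :=
  (u (X w) * (A w)%:R * ((Y w)%:R - mu1 (X w))
  - v (X w) * (e (X w) * ((1 - (A w)%:R) / (1 - e (X w)))) * ((Y w)%:R - mu0 (X w)))%R.

(** The a.s. bounds on the weights make the difference of the squares integrable; each square alone
    may have infinite mean. *)
Lemma efficiency_gap (W u v : S -> R) (K : R) :
    measurable_fun setT W -> measurable_fun setT u -> measurable_fun setT v ->
    {ae P, forall w, [/\ `|W (X w)| <= K, `|u (X w)| <= K & `|v (X w)| <= K]%R} ->
  'E_P[fun w => ((residual u v w + W (X w) * (A w)%:R) ^+ 2)%R] =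
  'E_P[fun w => ((residual u v w + W (X w) * e (X w)) ^+ 2)%R] +
  'E_P[fun w => (W (X w) ^+ 2 * e (X w) * (1 - e (X w)))%R].
Proof.
move=> mW mu mv bdd.
have [mmu0 mmu1] := measurable_outcome_regression.
pose XA := covariate_treatment A.
have mWX : measurable_fun setT (fun w => W (X w)) by exact: measurableT_comp.
have meX : measurable_fun setT (fun w => e (X w)) by exact: measurableT_comp.
have muX : measurable_fun setT (fun w => u (X w)) by exact: measurableT_comp.
have mvX : measurable_fun setT (fun w => v (X w)) by exact: measurableT_comp.
have mA' : measurable_fun setT (fun w => (A w)%:R : R).
  rewrite (_ : (fun _ => _) = \1_[set w | A w])//.
  by apply/funext => w; rewrite indic_bool.
have mY' : measurable_fun setT (fun w => (Y w)%:R : R).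
  rewrite (_ : (fun _ => _) = \1_[set w | Y w])//.
  by apply/funext => w; rewrite indic_bool.
(* F(X, A) is 2 W (A - e) h: h is u when A = 1 and - v e / (1 - e) when A = 0, where the sign
   cancels that of A - e = - e. *)
pose F (z : (S * bool)%type) : R := (2 * W z.1 * (if z.2 then (1 - e z.1) * u z.1
  else e z.1 * (v z.1 * (e z.1 / (1 - e z.1)))))%R.
have mF : measurable_fun setT F.
  apply: measurable_funM.
    by apply: measurable_funM => //; exact: (measurableT_comp mW measurable_fst).
  apply: (measurable_fun_if_pair (x := fun x => ((1 - e x) * u x)%R)
    (y := fun x => (e x * (v x * (e x / (1 - e x))))%R)).
    by apply: measurable_funM => //; exact: measurable_funB.
  apply: measurable_funM => //; apply: measurable_funM => //.
  by apply: measurable_funM => //; exact: measurable_inv_onem_propensity.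
have intF : P.-integrable setT (fun w => (F (XA w))%:E).
  (* The dominating function is 2 K^2 (1 + (1 - A) / (1 - e(X))). *)
  have int1 := finite_measure_integrable_cst P (2 * K ^+ 2)%R measurableT.
  have int2 := integrableZl measurableT (2 * K ^+ 2)%R integrable_inverse_propensity.
  apply: ae_le_integrable (integrableD measurableT int1 int2) _.
  - exact: (measurableT_comp mF).
  - apply: filterS bdd => w [bW bu bv] /=.
    have /andP[e0 e1] := e01 (X w).
    have i0 : (0 < (1 - e (X w))^-1)%R by rewrite invr_gt0 subr_gt0.
    have K0 : (0 <= K)%R by exact: le_trans bW.
    (* Used with c = 1 - e when A = 1 and c = e^2 / (1 - e) when A = 0; in both cases c is at most t
       = 1 + (1 - A) / (1 - e). *)
    have bound (a b c t : R) : (`|a| <= K -> `|b| <= K -> 0 <= c <= t ->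
        `|2 * a * (c * b)| <= 2 * K ^+ 2 * t)%R.
      move=> aK bK /andP[c0 ct]; rewrite [leLHS](_ : _ = 2 * (`|a| * `|b|) * c)%R.
        by apply: ler_pM => //; rewrite ?ler_pM2l ?expr2 ?ler_pM// mulr_ge0 ?mulr_ge0.
      by rewrite !normrM (ger0_norm c0) ger0_norm//; ring.
    apply: le_trans (ler_norm _); rewrite -[X in (X + _)%R]mulr1 -mulrDr /F /=.
    case: (A w) => /=.
      by apply: bound => //; rewrite subrr mul0r addr0 subr_ge0 ltW// gerBl ltW.
    rewrite [X in (_ * _ * X)%R](_ : _ =
      e (X w) * e (X w) / (1 - e (X w)) * v (X w))%R; last by ring.
    apply: bound => //; apply/andP; split; first by rewrite !mulr_ge0// ltW.
    rewrite subr0 mul1r -[leLHS]add0r lerD// ler_piMl ?(ltW i0)//.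
    by rewrite mulr_ile1// ltW.
(* First mean-zero term, by conditioning on (X, A). *)
have [intFY FY0] := is_cond_prob_residual (Z := XA) mY hmu mF intF.
have mW2 : measurable_fun setT (fun x => W x ^+ 2)%R by exact: measurable_funX.
have intW2 : P.-integrable setT (fun w => (W (X w) ^+ 2)%:E).
  apply: ae_le_integrable (finite_measure_integrable_cst P (K ^+ 2)%R measurableT) _.
    exact: measurable_funX.
  apply: filterS bdd => w [bW _ _] /=; have K0 : (0 <= K)%R by exact: le_trans bW.
  by rewrite !normrX (ger0_norm K0) lerXn2r ?nnegrE.
(* Second mean-zero term, W^2 (A - e), by conditioning on X. *)
have [intWA WA0] := is_cond_prob_residual mA he mW2 intW2.
have intgap : P.-integrable setT (fun w => (W (X w) ^+ 2 * e (X w) * (1 - e (X w)))%:E).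
  apply: ae_le_integrable intW2 _.
    apply: measurable_funM; last exact: measurable_funB.
    by apply: measurable_funM => //; exact: measurable_funX.
  apply: aeW => w /=; have /andP[e0 e1] := e01 (X w).
  have s0 : (0 <= 1 - e (X w))%R by rewrite subr_ge0 ltW.
  rewrite -mulrA normrM ler_piMr// ger0_norm ?mulr_ge0// ?(ltW e0)//.
  by rewrite mulr_ile1 ?gerBl// ltW.
have mres : measurable_fun setT (residual u v).
  rewrite /residual; apply: measurable_funB.
    apply: measurable_funM; first exact: measurable_funM.
    by apply: measurable_funB => //; exact: measurableT_comp.
  apply: measurable_funM; last by apply: measurable_funB => //; exact: measurableT_comp.
  apply: measurable_funM => //; apply: measurable_funM => //.
  apply: measurable_funM; first exact: measurable_funB.
  exact: (measurableT_comp measurable_inv_onem_propensity).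
have diffE : (fun w => ((residual u v w + W (X w) * (A w)%:R) ^+ 2
      - (residual u v w + W (X w) * e (X w)) ^+ 2)%:E) =
    (EFin \o (fun w => F (XA w) *
      (\1_[set w | Y w] w - (if A w then mu1 (X w) else mu0 (X w))))%R) \+
    ((EFin \o (fun w => W (X w) ^+ 2 * (\1_[set w | A w] w - e (X w)))%R) \+
    (EFin \o (fun w => W (X w) ^+ 2 * e (X w) * (1 - e (X w)))%R)).
  apply/funext => w; rewrite /= -!EFinD !indic_bool /F /residual /=; congr EFin.
  have e1 : (1 - e (X w) != 0)%R.
    by have /andP[_ e1] := e01 (X w); rewrite subr_eq0 gt_eqF.
  by case: (A w) => /=; field.
rewrite !unlock (ge0_integral_eqD
  (g := fun w => (residual u v w + W (X w) * e (X w)) ^+ 2)%R).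
- congr (_ + _); rewrite diffE.
  rewrite integralD_EFin//; last first.
    by apply: (integrableD measurableT intWA intgap).
  rewrite [X in X + _]FY0 add0e integralD_EFin//.
  by rewrite [X in X + _]WA0 add0e.
- by apply: measurable_funX; apply: measurable_funD => //; apply: measurable_funM.
- by apply: measurable_funX; apply: measurable_funD => //; apply: measurable_funM.
- by move=> w; rewrite sqr_ge0.
- by move=> w; rewrite sqr_ge0.
- rewrite diffE; apply: integrableD => //.
  exact: integrableD.
Qed.

End causation.

(** * Conditional independence and identification of the outcome regressions *)

Section conditional_independence.
Context {dO : measure_display} {Omega : measurableType dO} {R : realType}.
Context {d : measure_display} {S : measurableType d}.
Variables (P : probability Omega R) (Z : {mfun Omega >-> S}).

Lemma is_cond_prob_expectation (E : set Omega) (g : S -> R) :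
  is_cond_prob P Z E g -> 'E_P[fun w => g (Z w)] = P E.
Proof.
by move=> [_ /(_ _ measurableT)]; rewrite preimage_setT setIT unlock => ->.
Qed.

(** The definition of [cond_indep] provides some versions; a.s. uniqueness transfers the product
    rule to the given [g] and [h]. *)
Lemma cond_indep_is_cond_prob {d1 d2} {S1 : measurableType d1}
    {S2 : measurableType d2} (U : Omega -> S1) (V : Omega -> S2)
    (B : set S1) (C : set S2) (g h : S -> R) :
    cond_indep P U V Z -> measurable B -> measurable C ->
    measurable (U @^-1` B) -> measurable (V @^-1` C) ->
    is_cond_prob P Z (U @^-1` B) g -> is_cond_prob P Z (V @^-1` C) h ->
  is_cond_prob P Z (U @^-1` B `&` V @^-1` C) (fun z => g z * h z)%R.
Proof.
move=> UV mB mC mUB mVC gB hC; have [g' [h' [gB' hC' ghBC]]] := UV B C mB mC.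
apply: is_cond_prob_ae_eq ghBC _ _.
  by apply: measurable_funM; [exact: gB.1|exact: hC.1].
apply: filterS2 (is_cond_prob_unique mUB gB' gB) (is_cond_prob_unique mVC hC' hC).
by move=> w -> ->.
Qed.

(** Meant for U = (Y0, Y1) and B selecting Y^a = 1. With q = P(A = a | X), both mu_a q and, by
    ignorability, P(U in B | X) q are versions of P(U in B, A = a | X); positivity of q allows
    cancelling it. *)
Lemma outcome_regression_potential (A Y : {mfun Omega >-> bool})
    (e mu0 mu1 : S -> R) {d1} {S1 : measurableType d1} (U : Omega -> S1)
    (B : set S1) (a : bool) :
    is_propensity P Z A e -> is_outcome_regression P Z A Y mu0 mu1 ->
    (forall x, 0 < e x < 1)%R -> cond_indep P U A Z ->
    measurable B -> measurable (U @^-1` B) ->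
    [set w | Y w] `&` A @^-1` [set a] = U @^-1` B `&` A @^-1` [set a] ->
  is_cond_prob P Z (U @^-1` B) (if a then mu1 else mu0).
Proof.
move=> he hmu e01 UA mB mUB YU.
have mA := measurable_bool_event A.
have mAa : measurable (A @^-1` [set a]) by exact: measurable_funPTI.
pose q := if a then e else (fun x => 1 - e x)%R.
have hq : is_cond_prob P Z (A @^-1` [set a]) q.
  rewrite /q; case: a {YU mAa q} => //.
  rewrite (_ : _ @^-1` _ = ~` [set w | A w]); first exact: is_cond_prob_setC.
  by apply/seteqP; split=> w /=; [move=> ->|move/negP/negbTE].
have q0 x : (0 < q x)%R.
  by rewrite /q; have /andP[e0 e1] := e01 x; case: (a); rewrite ?subr_gt0.
have [mmu0 mmu1] := measurable_outcome_regression hmu.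
have mm : measurable_fun setT (if a then mu1 else mu0) by case: (a).
have ma : measurable [set a] by [].
have [g [h [gB ha ghBa]]] := UA B [set a] mB ma.
set m := if a then mu1 else mu0.
have hmq : is_cond_prob P Z (U @^-1` B `&` A @^-1` [set a]) (fun x => m x * q x)%R.
  split=> [|D mD]; first by apply: measurable_funM => //; exact: hq.1.
  have mZD : measurable (Z @^-1` D) by exact: measurable_funPTI.
  (* The outcome regression, a version given (X, A), is tested on the rectangle D x {a}; there the
     event Y = 1 coincides with U in B. *)
  have mDa : measurable (D `*` [set a]) by exact: measurableX.
  have [_ /(_ _ mDa)] := hmu.
  rewrite (_ : _ @^-1` (D `*` [set a]) = A @^-1` [set a] `&` Z @^-1` D); last first.
    by rewrite setIC; apply/seteqP; split.
  rewrite setIA YU => ->.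
  have -> : \int[P]_(w in A @^-1` [set a] `&` Z @^-1` D)
      (if (Z w, A w).2 then mu1 (Z w, A w).1 else mu0 (Z w, A w).1)%:E =
      \int[P]_(w in A @^-1` [set a]) ((m (Z w) * \1_D (Z w))%:E).
    rewrite integral_mkcondr; apply: eq_integral => w; rewrite inE /= => Aa.
    rewrite epatch_indic /= -EFinM Aa /m.
    by case: (a); rewrite !indicE.
  rewrite (is_cond_prob_integral (f := fun x => (m x * \1_D x)%R) mAa hq); last first.
    by apply: measurable_funM => //; exact: measurable_indic.
  rewrite [RHS]integral_mkcond epatch_indic; apply: eq_integral => w _ /=.
  by rewrite -EFinM mulrAC !indicE.
apply: is_cond_prob_ae_eq gB mm _.
have mUBa := measurableI _ _ mUB mAa.
apply: filterS2 (is_cond_prob_unique mUBa ghBa hmq) (is_cond_prob_unique mAa ha hq).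
by move=> w /= + hqw; rewrite hqw => /mulIf; apply; rewrite gt_eqF.
Qed.

End conditional_independence.

Lemma cprob_setC {dO : measure_display} {Omega : measurableType dO}
    {R : realType} (P : probability Omega R) (E F : set Omega) :
    measurable E -> measurable F -> (0 < P F) ->
  cprob P (~` E) F = (1 - fine (P (E `&` F)) / fine (P F))%R.
Proof.
move=> mE mF F0; have mEF : measurable (E `&` F) by exact: measurableI.
have fF : P F \is a fin_num by exact: fin_num_measure.
rewrite /cprob setIC -setDE measureD//; last by rewrite -ge0_fin_numE.
rewrite [F `&` E]setIC fineB//; last exact: fin_num_measure.
by rewrite mulrBl divff// gt_eqF// fine_gt0// F0 -ge0_fin_numE.
Qed.

(** * From an additive identity to the comparison of bounds *)

Section comparison.
Context {dO : measure_display} {Omega : measurableType dO} {R : realType}.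
Context {d : measure_display} {S : measurableType d}.
Variables (P : probability Omega R) (X : {mfun Omega >-> S}).

Lemma norm_cond_prob_le1 (E : set Omega) (g : S -> R) :
    measurable E -> is_cond_prob P X E g -> {ae P, forall w, `|g (X w)| <= 1}%R.
Proof.
move=> mE gE; apply: filterS2 (is_cond_prob_ge0 mE gE) (is_cond_prob_le1 mE gE).
by move=> w g0 g1; rewrite ger0_norm.
Qed.

(** The additive identity is meaningful for infinite bounds too; a finite [known] bound lets it be
    cancelled, which gives the form with a difference. *)
Lemma efficiency_comparison (unknown known gap : Omega -> R) :
    (forall w, 0 <= gap w)%R ->
    efficiency_bound P unknown = efficiency_bound P known + 'E_P[gap] ->
  [/\ efficiency_bound P known <= efficiency_bound P unknown,
      efficiency_bound P unknown = efficiency_bound P known + 'E_P[gap] &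
      efficiency_bound P known < +oo ->
        efficiency_bound P unknown - efficiency_bound P known = 'E_P[gap]].
Proof.
move=> gap0 ukE; rewrite ukE; split=> //.
  by rewrite leeDl// unlock integral_ge0// => w _; rewrite lee_fin.
move=> known_fin; rewrite addeAC subee ?add0e// ge0_fin_numE//.
by rewrite /efficiency_bound unlock integral_ge0// => w _; rewrite lee_fin sqr_ge0.
Qed.

End comparison.

(** * Identification of [beta] and the two efficiency comparisons *)

Theorem proposition1
  (R : realType) (d : measure_display) (Omega : measurableType d)
  (P : probability Omega R) (p : nat)
  (X : {RV P >-> p.-tuple R}) (A Y Y0 Y1 : {RV P >-> bool})
  (e mu0 mu1 : p.-tuple R -> R)
  (consistency : forall w, (Y w : nat) = (A w * Y1 w + (1 - A w) * Y0 w)%N)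
  (he : is_propensity P X A e)
  (hmu : is_outcome_regression P X A Y mu0 mu1)
  (hAY : 0 < P [set w | A w && Y w])
  (ignorability : strong_ignorability P X A Y0 Y1 e) :
  let m0 := m0 P X e mu0 in
  let m1 := m1 P X e mu1 in
  let m := m01 P X e mu0 mu1 in
  let beta := prob_necessity P A Y Y0 in
  (monotonicity P Y0 Y1 ->
    let bound := efficiency_bound P (eif_mono_unknown P X e mu0 mu1 A Y) in
    let bound_known := efficiency_bound P (eif_mono_known P X e mu0 mu1 A Y) in
    let gap := 'E_P[fun w => (1 / m1 ^+ 4
      * (m0 * mu1 (X w) - m1 * mu0 (X w)) ^+ 2 * e (X w) * (1 - e (X w)))%R] in
    [/\ beta = (1 - m0 / m1)%R,
        bound_known <= bound,
        bound = bound_known + gap &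
        bound_known < +oo -> bound - bound_known = gap])
  /\
  (cond_indep P Y0 Y1 X ->
    let bound := efficiency_bound P (eif_indep_unknown P X e mu0 mu1 A Y) in
    let bound_known := efficiency_bound P (eif_indep_known P X e mu0 mu1 A Y) in
    let gap := 'E_P[fun w => (1 / m1 ^+ 4
      * (m * mu1 (X w) - m1 * mu1 (X w) * mu0 (X w)) ^+ 2
      * e (X w) * (1 - e (X w)))%R] in
    [/\ beta = (1 - m / m1)%R,
        bound_known <= bound,
        bound = bound_known + gap &
        bound_known < +oo -> bound - bound_known = gap]).

Proof.
move=> m0 m1 m beta; have [UA e01] := ignorability.
have eP x : (0 < e x)%R /\ (0 < 1 - e x)%R.
  by have /andP[e0 e1] := e01 x; rewrite subr_gt0.
have mA := measurable_bool_event A.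
have mY := measurable_bool_event Y.
have mY0 := measurable_bool_event Y0.
have mY1 := measurable_bool_event Y1.
(* Ignorability concerns the pair (Y0, Y1), so the events Y0 = 1 and Y1 = 1 are written as preimages
   under that pair. *)
pose fstT := [set y : bool * bool | y.1].
pose sndT := [set y : bool * bool | y.2].
have mfst : measurable fstT.
  by rewrite -[X in measurable X]setTI; exact: (measurable_fst measurableT).
have msnd : measurable sndT.
  by rewrite -[X in measurable X]setTI; exact: (measurable_snd measurableT).
have YA : [set w | A w && Y w] = [set w | Y1 w] `&` [set w | A w].
  apply/seteqP; split=> w /=; have := consistency w.
    by case: (A w) (Y w) (Y0 w) (Y1 w) => [] [] [] [].
  by case: (A w) (Y w) (Y0 w) (Y1 w) => [] [] [] [] //= _ [].
have Y0A : [set w | Y w] `&` A @^-1` [set false] =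
    [set w | Y0 w] `&` A @^-1` [set false].
  apply/seteqP; split=> w /= [+ Aw]; have := consistency w; rewrite Aw;
    by case: (Y w) (Y0 w) (Y1 w) => [] [] [].
have Y1A : [set w | Y w] `&` A @^-1` [set true] =
    [set w | Y1 w] `&` A @^-1` [set true].
  apply/seteqP; split=> w /= [+ Aw]; have := consistency w; rewrite Aw;
    by case: (Y w) (Y0 w) (Y1 w) => [] [] [].
have mAY : measurable [set w | A w && Y w] by rewrite YA; exact: measurableI.
have h0 : is_cond_prob P X [set w | Y0 w] mu0.
  exact: (outcome_regression_potential (B := fstT) he hmu e01 UA mfst mY0 Y0A).
have h1 : is_cond_prob P X [set w | Y1 w] mu1.
  exact: (outcome_regression_potential (B := sndT) he hmu e01 UA msnd mY1 Y1A).
(* By ignorability mu_0 e is a version of P(Y0 = 1, A = 1 | X), whose mean is the probability of the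
   event. The same argument for [m1] gives P(A = 1, Y = 1), nonzero by [hAY]. *)
have m0E : m0 = fine (P ([set w | Y0 w] `&` [set w | A w])).
  rewrite -(is_cond_prob_expectation (cond_indep_is_cond_prob
    (B := fstT) (C := [set a : bool | a]) UA mfst _ mY0 mA h0 he))//.
have m1E : m1 = fine (P [set w | A w && Y w]).
  rewrite YA -(is_cond_prob_expectation (cond_indep_is_cond_prob
    (B := sndT) (C := [set a : bool | a]) UA msnd _ mY1 mA h1 he))//.
have m1_neq0 : m1 != 0%R.
  by rewrite m1E gt_eqF// fine_gt0// hAY -ge0_fin_numE//; exact: fin_num_measure.
have ab0 := norm_cond_prob_le1 mY0 h0.
have ab1 := norm_cond_prob_le1 mY1 h1.
(* Common to both cases: only P(Y0 = 1, A = 1, Y = 1) remains to be identified. *)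
have betaE : beta = (1 - fine (P ([set w | Y0 w] `&` [set w | A w && Y w])) / m1)%R.
  rewrite m1E -cprob_setC//.
  by congr (cprob _ _ _); apply/seteqP; split=> w /= /negP.
have [mmu0 mmu1] := measurable_outcome_regression hmu.
have mcst (c : R) : measurable_fun [set: p.-tuple R] (fun=> c) by exact: measurable_cst.
split=> [mono|Y01].
(* Under monotonicity Y0 = 1 forces Y1 = 1 a.s., hence Y = 1 when A = 1. *)
- have m0A : P ([set w | Y0 w] `&` [set w | A w && Y w]) =
      P ([set w | Y0 w] `&` [set w | A w]).
    rewrite YA; apply: ae_eq_measure; [by do ?apply: measurableI..|].
    apply: filterS mono => w Y01; split=> /= [[Y0w [_ Aw]]//|[Y0w Aw]].
    by move: Y01; rewrite Y0w lt0b.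
  have betam : beta = (1 - m0 / m1)%R by rewrite betaE m0A m0E.
  move=> bound bound_known gap.
  (* [u] and [v] are read off the two residual terms, and [W] off the coefficient of A in the
     influence function for unknown e; W^2 is the weight in the gap. *)
  pose u (x : p.-tuple R) := (m0 / m1 ^+ 2)%R.
  pose v (x : p.-tuple R) := (m1^-1)%R.
  pose W x := ((m0 * mu1 x - m1 * mu0 x) / m1 ^+ 2)%R.
  suff E : bound = bound_known + gap.
    have [|? ? ?] := efficiency_comparison _ E; last by split.
    move=> w; have [e0 e1] := eP (X w).
    do 3?apply: mulr_ge0; rewrite ?sqr_ge0 ?(ltW e0) ?(ltW e1)//.
    by rewrite div1r invr_ge0 exprn_even_ge0.
  have mW : measurable_fun setT W.
    apply: measurable_funM => //.
    by apply: measurable_funB; apply: measurable_funM.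
  have [K bdd] : exists K, {ae P, forall w,
      [/\ `|W (X w)| <= K, `|u (X w)| <= K & `|v (X w)| <= K]%R}.
    (* As |mu_0| and |mu_1| are a.s. at most 1, the triangle inequality bounds W by the sum of its
       coefficients. *)
    exists (`|m0 / m1 ^+ 2| + `|m1^-1|)%R.
    apply: filterS2 ab0 ab1 => w b0 b1; split; rewrite ?lerDl ?lerDr//.
    rewrite (_ : W (X w) = m0 / m1 ^+ 2 * mu1 (X w) - m1^-1 * mu0 (X w))%R.
      by apply: le_trans (ler_normB _ _) _; rewrite !normrM lerD// ler_piMr.
    by rewrite /W; field.
  have gapE := efficiency_gap he hmu e01 mW (mcst _) (mcst _) bdd.
  have unknownE : eif_mono_unknown P X e mu0 mu1 A Y =
      (fun w => residual X A Y e mu0 mu1 u v w + W (X w) * (A w)%:R)%R.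
    apply/funext => w; rewrite /eif_mono_unknown /residual /W /u /v -/m0 -/m1.
    have [_ /lt0r_neq0 e1] := eP (X w); by field; rewrite e1 m1_neq0.
  have knownE : eif_mono_known P X e mu0 mu1 A Y =
      (fun w => residual X A Y e mu0 mu1 u v w + W (X w) * e (X w))%R.
    apply/funext => w; rewrite /eif_mono_known /residual /W /u /v -/m0 -/m1.
    have [_ /lt0r_neq0 e1] := eP (X w); by field; rewrite e1 m1_neq0.
  rewrite /bound /bound_known /efficiency_bound unknownE knownE gapE.
  congr (_ + _); rewrite /gap; congr expectation; apply/funext => w.
  by rewrite /W; field.
(* Conditional independence gives the joint law of Y0 and Y1 given X; ignorability for the event Y0
   = Y1 = 1 then brings in the factor e, which identifies [m]. *)
- have h01 : is_cond_prob P X ([set w | Y0 w] `&` [set w | Y1 w]) (fun x => mu0 x * mu1 x)%R.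
    exact: (cond_indep_is_cond_prob (B := [set b : bool | b])
      (C := [set b : bool | b]) Y01 _ _ mY0 mY1 h0 h1).
  have mE : m = fine (P ([set w | Y0 w] `&` [set w | A w && Y w])).
    rewrite YA setIA -(is_cond_prob_expectation (cond_indep_is_cond_prob
      (B := fstT `&` sndT) (C := [set a : bool | a]) UA
      (measurableI _ _ mfst msnd) _ (measurableI _ _ mY0 mY1) mA h01 he))//.
    rewrite /m /m01; congr (fine (expectation _ _)); apply/funext => w.
    by rewrite [(mu1 _ * _)%R]mulrC.
  have betam : beta = (1 - m / m1)%R by rewrite betaE mE.
  move=> bound bound_known gap.
  (* The weights now depend on x. The coefficient [u] of the treated residual also multiplies mu_1
     in the covariate term, so W = u mu_1. *)
  pose u x := (m / m1 ^+ 2 - mu0 x / m1)%R.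
  pose v x := (mu1 x / m1)%R.
  pose W x := (u x * mu1 x)%R.
  suff E : bound = bound_known + gap.
    have [|? ? ?] := efficiency_comparison _ E; last by split.
    move=> w; have [e0 e1] := eP (X w).
    do 3?apply: mulr_ge0; rewrite ?sqr_ge0 ?(ltW e0) ?(ltW e1)//.
    by rewrite div1r invr_ge0 exprn_even_ge0.
  have mu' : measurable_fun setT u.
    by apply: measurable_funB => //; apply: measurable_funM.
  have mv : measurable_fun setT v by exact: measurable_funM.
  have mW : measurable_fun setT W by exact: measurable_funM.
  have [K bdd] : exists K, {ae P, forall w,
      [/\ `|W (X w)| <= K, `|u (X w)| <= K & `|v (X w)| <= K]%R}.
    exists (`|m / m1 ^+ 2| + `|m1^-1|)%R.
    apply: filterS2 ab0 ab1 => w b0 b1.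
    have uK : (`|u (X w)| <= `|m / m1 ^+ 2| + `|m1^-1|)%R.
      by apply: le_trans (ler_normB _ _) _; rewrite lerD2l normrM ler_piMl.
    split=> //; first by rewrite normrM (le_trans _ uK)// ler_piMr.
    by rewrite normrM (@le_trans _ _ `|m1^-1|%R) ?lerDr// ler_piMl.
  have gapE := efficiency_gap he hmu e01 mW mu' mv bdd.
  have unknownE : eif_indep_unknown P X e mu0 mu1 A Y =
      (fun w => residual X A Y e mu0 mu1 u v w + W (X w) * (A w)%:R)%R.
    apply/funext => w; rewrite /eif_indep_unknown /residual /W /u /v -/m -/m1.
    have [_ /lt0r_neq0 e1] := eP (X w); by field; rewrite e1 m1_neq0.
  have knownE : eif_indep_known P X e mu0 mu1 A Y =
      (fun w => residual X A Y e mu0 mu1 u v w + W (X w) * e (X w))%R.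
    apply/funext => w; rewrite /eif_indep_known /residual /W /u /v -/m -/m1.
    have [_ /lt0r_neq0 e1] := eP (X w); by field; rewrite e1 m1_neq0.
  rewrite /bound /bound_known /efficiency_bound unknownE knownE gapE.
  congr (_ + _); rewrite /gap; congr expectation; apply/funext => w.
  by rewrite /W /u; field.
Qed.
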